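(* Let $n\ge 2$ and $1\le k\le n-1$, and let $\Gamma$ be a connected simple graph on $n$ vertices with vertex-connectivity $k$. Then \[ SO(\Gamma)\le \sqrt{2}\binom{n-k-1}{2}(n-2)+\sqrt{2}\binom{k}{2}(n-1)+k(n-k-1)\sqrt{(n-1)^2+(n-2)^2}+k\sqrt{(n-1)^2+k^2}, \] with equality if and only if $\Gamma\cong (K_{n-k-1}\cup K_1)\vee K_k$.
   Context: The Sombor index of a graph $\Gamma$ is $SO(\Gamma)=\sum_{uv\in E(\Gamma)}\sqrt{\deg_\Gamma(u)^2+\deg_\Gamma(v)^2}$. The vertex-connectivity of a graph is the minimum size of a vertex set whose removal disconnects the graph, with the convention that $K_n$ has vertex-connectivity $n-1$. $\binom{m}{2}=0$ for $m<2$. $G\cup H$ is the disjoint union and $G\vee H$ is the join (disjoint union plus all edges between $G$ and $H$); $K_0$ is the empty graph, so for $k=n-1$ the extremal graph is $K_n$. *)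

(* Defs.v *)
From mathcomp Require Import all_boot all_order all_algebra.
From mathcomp Require Import reals.

Set Implicit Arguments.
Unset Strict Implicit.
Unset Printing Implicit Defensive.

Import Order.TTheory GRing.Theory Num.Theory.

Record sgraph := SGraph {
  vertex :> finType;
  edge : rel vertex;
  edge_sym : symmetric edge;
  edge_irr : irreflexive edge
}.

Definition deg (G : sgraph) (x : G) : nat := #|[set y : G | edge x y]|.

Definition edges (G : sgraph) : {set {set G}} :=
  [set [set x.1; x.2] | x : G * G & edge x.1 x.2].

(* An edge uv is the two-element set {u, v}, so the inner sum is
   deg(u)^2 + deg(v)^2. *)
Definition sombor (R : realType) (G : sgraph) : R :=
  (\sum_(uv in edges G) Num.sqrt (\sum_(x in uv) (deg x)%:R ^+ 2))%R.

(* The graph without vertices counts as connected here; this is what makes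
   the removal of all vertices not disconnect a graph. *)
Definition connected (G : sgraph) : bool :=
  [forall x : G, forall y : G, connect (@edge G) x y].

Definition complete (G : sgraph) : bool :=
  [forall x : G, forall y : G, (x != y) ==> edge x y].

Section Induced.
Variables (G : sgraph) (A : {set G}).

Definition induced_edge : rel {x : G | x \in A} :=
  fun x y => edge (val x) (val y).

Fact induced_edge_sym : symmetric induced_edge.
Proof. by move=> x y; apply: edge_sym. Qed.

Fact induced_edge_irr : irreflexive induced_edge.
Proof. by move=> x; apply: edge_irr. Qed.

Definition induced : sgraph := SGraph induced_edge_sym induced_edge_irr.
End Induced.

Definition disconnecting (G : sgraph) (S : {set G}) : bool :=
  ~~ connected (induced (~: S)).

(* A graph that is not complete has a disconnecting set (the complement of two
   non-adjacent vertices), so the default value #|G| of the minimum is never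
   attained. *)
Definition vertex_connectivity (G : sgraph) : nat :=
  if complete G then #|G|.-1
  else \big[minn/#|G|]_(S : {set G} | disconnecting S) #|S|.

Section CompleteGraph.
Variable m : nat.

Definition K_edge : rel 'I_m := fun x y => x != y.

Fact K_edge_sym : symmetric K_edge.
Proof. by move=> x y; rewrite /K_edge eq_sym. Qed.

Fact K_edge_irr : irreflexive K_edge.
Proof. by move=> x; rewrite /K_edge eqxx. Qed.

Definition K : sgraph := SGraph K_edge_sym K_edge_irr.
End CompleteGraph.

Section UnionJoin.
Variables G H : sgraph.

Definition gunion_edge : rel (G + H)%type := fun x y =>
  match x, y with
  | inl u, inl v => edge u v
  | inr u, inr v => edge u v
  | _, _ => false
  end.

Fact gunion_edge_sym : symmetric gunion_edge.
Proof. by move=> [u|u] [v|v] //=; apply: edge_sym. Qed.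

Fact gunion_edge_irr : irreflexive gunion_edge.
Proof. by move=> [u|u] /=; apply: edge_irr. Qed.

Definition gunion : sgraph := SGraph gunion_edge_sym gunion_edge_irr.

Definition gjoin_edge : rel (G + H)%type := fun x y =>
  match x, y with
  | inl u, inl v => edge u v
  | inr u, inr v => edge u v
  | _, _ => true
  end.

Fact gjoin_edge_sym : symmetric gjoin_edge.
Proof. by move=> [u|u] [v|v] //=; apply: edge_sym. Qed.

Fact gjoin_edge_irr : irreflexive gjoin_edge.
Proof. by move=> [u|u] /=; apply: edge_irr. Qed.

Definition gjoin : sgraph := SGraph gjoin_edge_sym gjoin_edge_irr.
End UnionJoin.

Definition giso (G H : sgraph) : Prop :=
  exists2 f : G -> H, bijective f & forall x y, edge (f x) (f y) = edge x y.

Definition sombor_bound (R : realType) (n k : nat) : R :=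
  (Num.sqrt 2 * 'C(n - k - 1, 2)%:R * (n - 2)%:R
   + Num.sqrt 2 * 'C(k, 2)%:R * (n - 1)%:R
   + k%:R * (n - k - 1)%:R * Num.sqrt ((n - 1)%:R ^+ 2 + (n - 2)%:R ^+ 2)
   + k%:R * Num.sqrt ((n - 1)%:R ^+ 2 + k%:R ^+ 2))%R.

(* Main.v *)
(** Counted over ordered pairs of adjacent vertices, the Sombor index increases
    strictly when edges are added. A minimum cut of size [k] whose removal
    separates [a] vertices from the remaining [b] exhibits the graph as a
    spanning subgraph of [(K_a U K_b) v K_k], whose Sombor index has the form
    [u a + u b + const] with [u] strictly convex. Since [a + b = n - k] is
    fixed, the maximum is reached exactly when one of the two parts is a single
    vertex. A complete graph is the degenerate case [a = 0], [b = 1]. *)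
Require Import Defs.
From mathcomp Require Import all_boot all_order all_algebra.
From mathcomp Require Import reals.
From mathcomp Require Import ring lra zify.
Import Order.TTheory GRing.Theory Num.Theory.
Set Implicit Arguments.
Unset Strict Implicit.
Unset Printing Implicit Defensive.

(** * Ordered pairs and monotonicity under added edges *)

(** Each edge arises from two distinct ordered pairs with equal terms. Sums over pairs can be
    reindexed along a vertex bijection. *)
Lemma sombor_pairs (R : realType) (G : sgraph) :
  (sombor R G *+ 2 = \sum_(p : G * G | edge p.1 p.2)
     Num.sqrt ((deg p.1)%:R ^+ 2 + (deg p.2)%:R ^+ 2))%R.
Proof.
rewrite /sombor -sumrMnl.
rewrite [RHS](partition_big (fun p : G * G => [set p.1; p.2])
  (mem (edges G))) /=; last first.
  by move=> p ep; apply/imsetP; exists p; rewrite ?inE.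
apply: eq_bigr => uv /imsetP[[x y]] /=; rewrite inE /= => exy ->.
have nxy : x != y by apply: contraTneq exy => ->; rewrite edge_irr.
rewrite big_setU1 ?inE //= big_set1 [RHS](bigD1 (x, y)) /=; last first.
  by rewrite exy eqxx.
rewrite [in RHS](bigD1 (y, x)) /=; last first.
  by rewrite edge_sym exy setUC eqxx xpair_eqE eq_sym (negbTE nxy).
rewrite big1 ?addr0; last first.
  move=> [a b] /=; rewrite -!andbA => /and4P[eab /eqP Eab n1 n2].
  have: a \in [set x; y] by rewrite -Eab !inE eqxx.
  have: b \in [set x; y] by rewrite -Eab !inE eqxx orbT.
  by rewrite !inE => /orP[]/eqP Eb /orP[]/eqP Ea; move: eab n1 n2;
     rewrite Ea Eb ?edge_irr ?eqxx.
by rewrite mulr2n; congr (_ + Num.sqrt _)%R; rewrite addrC.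
Qed.

(** Such an [f] makes [G] a spanning subgraph of [H]: no degree drops, so no term drops. The
    equality condition says that [f] is an isomorphism. *)
Lemma sombor_hom (R : realType) (G H : sgraph) (f : G -> H) :
  bijective f -> (forall x y, edge x y -> edge (f x) (f y)) ->
  (sombor R G <= sombor R H
     ?= iff [forall p : G * G, edge (f p.1) (f p.2) == edge p.1 p.2])%R.
Proof.
move=> bf homf; have injf := bij_inj bf.
have degf x : deg x <= deg (f x).
  rewrite /deg -(card_imset _ injf); apply: subset_leq_card.
  by apply/subsetP=> _ /imsetP[y + ->]; rewrite !inE; apply: homf.
have deg_gt0 (x y : H) : edge x y -> 0 < deg x.
  by move=> exy; apply/card_gt0P; exists y; rewrite inE.
suff: (sombor R G *+ 2 <= sombor R H *+ 2
     ?= iff [forall p : G * G, edge (f p.1) (f p.2) == edge p.1 p.2])%R.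
  by rewrite /Order.leif lerMn2r eqrMn2r.
have bff : bijective (fun p : G * G => (f p.1, f p.2)).
  case: bf => g fK gK; exists (fun p => (g p.1, g p.2)) => -[x y] /=;
  by rewrite ?fK ?gK.
rewrite !sombor_pairs [X in (_ <= X ?= iff _)%R](reindex _ (onW_bij _ bff)) /=.
rewrite [X in (X <= _ ?= iff _)%R]big_mkcond.
rewrite [X in (_ <= X ?= iff _)%R]big_mkcond /=.
set F := (X in (\sum_i X i <= _ ?= iff _)%R).
set F' := (X in (_ <= \sum_i X i ?= iff _)%R).
have leF p : (F p <= F' p)%R.
  rewrite /F /F'; case: ifP => [/homf->|_]; last first.
    by case: ifP; rewrite ?sqrtr_ge0.
  rewrite ler_sqrt ?addr_ge0 ?exprn_ge0 // lerD // lerXn2r ?nnegrE //;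
    by rewrite ler_nat.
split; first by apply: ler_sum => p _; apply: leF.
apply/idP/forallP => [/eqP eqs [x y] /= | isof].
  apply/eqP; apply/idP/idP => [efxy|]; last exact: homf.
  (* An edge of [H] absent from [G] has term zero on the left and a positive term on the right,
     since its ends have positive degree in [H]. *)
  move: eqs; apply: contra_eqT => nexy; rewrite lt_eqF //.
  rewrite (bigD1 (x, y)) // [X in (_ < X)%R](bigD1 (x, y)) //=.
  rewrite ltr_leD ?ler_sum // /F /F' /= (negbTE nexy) efxy sqrtr_gt0.
  by rewrite ltr_wpDr ?exprn_ge0 // exprn_gt0 // ltr0n (deg_gt0 _ _ efxy).
have edgef x y : edge (f x) (f y) = edge x y by apply/eqP; have := isof (x, y).
have degE x : deg (f x) = deg x.
  rewrite /deg -(card_imset _ injf); apply/eq_card => y.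
  by have [g fK gK] := bf; rewrite -[y]gK mem_imset // !inE edgef.
by apply/eqP/eq_bigr => -[x y] _; rewrite /F /F' /= edgef !degE.
Qed.

(** * The Sombor index of two cliques joined to a third *)

Definition two_cliques_join (a b k : nat) : sgraph :=
  gjoin (gunion (K a) (K b)) (K k).

Lemma sum_two_cliques_join (R : nmodType) (a b k : nat)
    (P : pred (two_cliques_join a b k)) (F : two_cliques_join a b k -> R) :
  (\sum_(x | P x) F x = \sum_(i < a | P (inl (inl i))) F (inl (inl i))
    + \sum_(i < b | P (inl (inr i))) F (inl (inr i))
    + \sum_(i < k | P (inr i)) F (inr i))%R.
Proof. by rewrite big_sumType /= big_sumType. Qed.

Lemma card_ord_neq m (i : 'I_m) : #|[pred j | K_edge i j]| = m.-1.
Proof.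
rewrite -[m in RHS]card_ord (cardD1 i predT) /=.
by apply: eq_card => j; rewrite !inE andbT eq_sym.
Qed.

Lemma deg_two_cliques_join (a b k : nat) (x : two_cliques_join a b k) :
  deg x = match x with
          | inl (inl _) => a.-1 + k
          | inl (inr _) => b.-1 + k
          | inr _ => a + b + k.-1
          end.
Proof.
rewrite /deg cardsE -sum1_card sum_two_cliques_join.
by case: x => [[i|i]|i]; rewrite /= ?big_pred0_eq !sum1_card
  ?card_ord_neq ?card_ord ?addr0 ?add0r.
Qed.

Lemma natr_bin2 (R : realType) (m : nat) :
  ('C(m, 2)%:R = m%:R * (m%:R - 1) / 2 :> R)%R.
Proof.
elim: m => [|m IHm]; first by rewrite bin0n /= !mul0r.
by rewrite binS bin1 natrD IHm -natr1; field.
Qed.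

Lemma giso_two_cliques_joinC (a b k : nat) :
  giso (two_cliques_join a b k) (two_cliques_join b a k).
Proof.
pose swap c d (x : two_cliques_join c d k) : two_cliques_join d c k :=
  match x with
  | inl (inl i) => inl (inr i)
  | inl (inr i) => inl (inl i)
  | inr i => inr i
  end.
exists (@swap a b); last by move=> [[i|i]|i] [[j|j]|j].
by exists (@swap b a); case=> [[i|i]|i].
Qed.

(* The contribution of a clique [K_x] of [(K_x U K_y) v K_k] to the Sombor
   index, from its own edges and its edges to [K_k], where [n = x + y + k]. *)
Definition clique_weight (R : realType) (n k x : nat) : R :=
  (Num.sqrt 2 * 'C(x, 2)%:R * (x + k - 1)%:R
   + k%:R * x%:R * Num.sqrt ((n - 1)%:R ^+ 2 + (x + k - 1)%:R ^+ 2))%R.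

Lemma sombor_two_cliques_join (R : realType) (a b k : nat) : 0 < k ->
  (sombor R (two_cliques_join a b k) =
   clique_weight R (a + b + k) k a + clique_weight R (a + b + k) k b
   + Num.sqrt 2 * 'C(k, 2)%:R * (a + b + k - 1)%:R)%R.
Proof.
move=> k_gt0.
have sq2 (x : nat) :
    (Num.sqrt (x%:R ^+ 2 + x%:R ^+ 2) = Num.sqrt 2 * x%:R :> R)%R.
  have -> : (x%:R ^+ 2 + x%:R ^+ 2 = 2 * x%:R ^+ 2 :> R)%R by ring.
  by rewrite sqrtrM // sqrtr_sqr ger0_norm.
have binE m : ('C(m, 2)%:R *+ 2 = m%:R * m.-1%:R :> R)%R.
  rewrite natr_bin2; case: m => [|m] /=; first by rewrite !mul0r mul0rn.
  by rewrite -natr1; field.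
(* The summands count ordered pairs inside the clique, from it to [K k], and from [K k] back to
   it. *)
have Ew m : (m%:R * m.-1%:R * Num.sqrt ((m.-1 + k)%:R ^+ 2 + (m.-1 + k)%:R ^+ 2)
   + m%:R * k%:R * Num.sqrt ((m.-1 + k)%:R ^+ 2 + (a + b + k.-1)%:R ^+ 2)
   + k%:R * m%:R * Num.sqrt ((a + b + k.-1)%:R ^+ 2 + (m.-1 + k)%:R ^+ 2)
   = clique_weight R (a + b + k) k m *+ 2)%R.
  (* For [m = 0] the truncated [m.-1 + k] differs from [m + k - 1], but every coefficient
     vanishes. *)
  case: m => [|m]; first by
    rewrite /clique_weight bin0n !(mul0r, mulr0) !addr0 mul0rn.
  have -> : a + b + k.-1 = a + b + k - 1 by lia.
  have -> : m.+1.-1 + k = m.+1 + k - 1 by lia.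
  rewrite sq2 -binE /clique_weight.
  rewrite [((m.+1 + k - 1)%:R ^+ 2 + _)%R]addrC.
  set s := Num.sqrt (_ + _)%R; ring.
apply: (@pmulrnI _ 2) => //; rewrite sombor_pairs.
rewrite -(pair_big_dep predT (fun x y => edge x y)
  (fun x y => Num.sqrt ((deg x)%:R ^+ 2 + (deg y)%:R ^+ 2))%R) /=.
under eq_bigr => x _ do under eq_bigr => y _ do rewrite !deg_two_cliques_join.
under eq_bigr => x _ do rewrite sum_two_cliques_join.
rewrite sum_two_cliques_join /= !big_pred0_eq.
under eq_bigr => i _ do rewrite !sumr_const card_ord_neq card_ord.
under [X in (_ + X + _)%R]eq_bigr => i _ do
  rewrite !sumr_const card_ord_neq card_ord.
under [X in (_ + _ + X)%R]eq_bigr => i _ do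
  rewrite !sumr_const card_ord_neq !card_ord.
rewrite !sumr_const !card_ord [in RHS]mulrnDl [in RHS]mulrnDl -!Ew !sq2.
have -> : a + b + k.-1 = a + b + k - 1 by lia.
have -> (s d : R) : (s * 'C(k, 2)%:R * d *+ 2 = s * (k%:R * k.-1%:R) * d)%R.
  by rewrite -binE; ring.
ring.
Qed.

(** * Convexity of the clique weight *)

Lemma sqrt_midpoint_convex (R : realType) (c z : R) :
  (2 * Num.sqrt (c ^+ 2 + z ^+ 2) <=
   Num.sqrt (c ^+ 2 + (z + 1) ^+ 2) + Num.sqrt (c ^+ 2 + (z - 1) ^+ 2))%R.
Proof.
have ge0 (x y : R) : (0 <= x ^+ 2 + y ^+ 2)%R by rewrite addr_ge0 ?sqr_ge0.
set r := Num.sqrt (c ^+ 2 + z ^+ 2); set p := Num.sqrt _; set q := Num.sqrt _.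
have r0 : (0 <= r)%R by exact: sqrtr_ge0.
have p0 : (0 <= p)%R by exact: sqrtr_ge0.
have q0 : (0 <= q)%R by exact: sqrtr_ge0.
have r2 : (r ^+ 2 = c ^+ 2 + z ^+ 2)%R by rewrite sqr_sqrtr.
have p2 : (p ^+ 2 = c ^+ 2 + (z + 1) ^+ 2)%R by rewrite sqr_sqrtr.
have q2 : (q ^+ 2 = c ^+ 2 + (z - 1) ^+ 2)%R by rewrite sqr_sqrtr.
(* Cauchy-Schwarz for the vectors [(c, z + 1)] and [(c, z - 1)], of lengths [p] and [q]; the squares
   of the two sides differ by [(2 * c) ^+ 2]. *)
have pq : (c ^+ 2 + z ^+ 2 - 1 <= p * q)%R.
  have [neg|pos] := ltP (c ^+ 2 + z ^+ 2 - 1)%R 0%R.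
    by apply: (le_trans (ltW neg)); rewrite mulr_ge0.
  rewrite -(@ler_pXn2r _ 2) ?nnegrE ?mulr_ge0 // exprMn p2 q2 -subr_ge0.
  rewrite (_ : (_ - _ = (2 * c) ^+ 2)%R) ?sqr_ge0 //; ring.
rewrite -(@ler_pXn2r _ 2) ?nnegrE ?mulr_ge0 ?addr_ge0 // exprMn r2.
by rewrite (sqrrD p) p2 q2 mulr2n; nra.
Qed.

(** Strictness comes from the cubic binomial term; the square-root term only has a nonnegative
    second difference. *)
Lemma clique_weight_convex (R : realType) (n k x : nat) : 0 < k ->
  (clique_weight R n k x.+1 - clique_weight R n k x
   < clique_weight R n k x.+2 - clique_weight R n k x.+1)%R.
Proof.
move=> k0.
pose z : R := (x%:R + k%:R)%R.
have d0 : ((x + k - 1)%:R = z - 1 :> R)%R by rewrite natrB ?natrD //; lia.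
have d1 : ((x.+1 + k - 1)%:R = z :> R)%R by rewrite addSn subn1 natrD.
have d2 : ((x.+2 + k - 1)%:R = z + 1 :> R)%R.
  by rewrite !addSn subn1 -natr1 natrD.
rewrite /clique_weight !natr_bin2 d0 d1 d2 -[x.+2%:R%R]natr1 -[x.+1%:R%R]natr1.
have := sqrt_midpoint_convex ((n - 1)%:R : R)%R z.
have x0 : (0 <= x%:R :> R)%R by [].
have k1 : (1 <= k%:R :> R)%R by rewrite ler1n.
have s0 : (0 < Num.sqrt 2 :> R)%R by rewrite sqrtr_gt0.
have : (Num.sqrt ((n - 1)%:R ^+ 2 + (z - 1) ^+ 2) <=
        Num.sqrt ((n - 1)%:R ^+ 2 + (z + 1) ^+ 2) :> R)%R.
  rewrite ler_sqrt ?addr_ge0 ?sqr_ge0 // lerD2l -subr_ge0.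
  have -> : ((z + 1) ^+ 2 - (z - 1) ^+ 2 = 4 * z)%R by ring.
  by rewrite mulr_ge0 ?addr_ge0.
rewrite /z.
set r0 := Num.sqrt (_ + (_ - 1) ^+ 2)%R.
set r1 := Num.sqrt (_ + (_ + k%:R) ^+ 2)%R.
set r2 := Num.sqrt (_ + (_ + 1) ^+ 2)%R; set s := Num.sqrt 2.
move: (x%:R)%R (k%:R)%R x0 k1 r0 r1 r2 => X Y x0 k1 r0 r1 r2 mono conv.
rewrite -subr_gt0.
(* The product [x h(x)] of [x] and a convex increasing [h] is convex. *)
rewrite (_ : (_ - _ = s * (3 * X + Y + 1)
   + Y * ((X + 1) * (r2 + r0 - 2 * r1) + (r2 - r0)))%R); last by field.
apply: ltr_wpDr; last by rewrite mulr_gt0 //; lra.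
apply: mulr_ge0; first lra.
by apply: addr_ge0; [apply: mulr_ge0|]; lra.
Qed.

(** Increments of [u] grow, so moving units from one argument to the other raises the sum. The
    successors keep both arguments positive, as the parts left by a cut are nonempty. *)
Lemma strictly_convex_spread (R : realType) (u : nat -> R) (a b : nat) :
  (forall x, u x.+1 - u x < u x.+2 - u x.+1)%R ->
  (u a.+1 + u b.+1 <= u (a + b).+1 + u 1 ?= iff (a == 0) || (b == 0))%R.
Proof.
move=> convu.
case: b => [|b]; first by rewrite addn0 orbT; apply/leif_refl.
rewrite orbF.
have incr x y : (u x.+1 - u x < u (x + y).+2 - u (x + y).+1)%R.
  elim: y => [|y IHy]; first by rewrite addn0.
  by rewrite addnS; apply: lt_trans IHy _.
(* From [c] to [c.+1] both sides gain an increment of [u], and the one on the right is taken at a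
   larger argument. *)
have lt c : (u c.+2 + u b.+2 < u (c.+1 + b.+1).+1 + u 1)%R.
  elim: c => [|c IHc]; first by have := incr 1 b; rewrite !add1n; lra.
  have := incr c.+2 b; rewrite !addSn !addnS in IHc *; lra.
case: a => [|a]; first by rewrite add0n addrC; apply/leif_refl.
by split; [exact: ltW | rewrite lt_eqF].
Qed.

(** * Embedding a graph with a cut into two joined cliques *)

(** Elements of corresponding fibres are matched by their positions in the enumerations. *)
Lemma bij_of_card_fibers (T U C : finType) (c : T -> C) (d : U -> C) :
  (forall i, #|[pred x | c x == i]| = #|[pred y | d y == i]|) ->
  exists2 f : T -> U, bijective f & forall x, d (f x) = c x.
Proof.
move=> eq_fib.
have fibP x : {i : 'I_#|[pred y | d y == c x]| |
               i = index x (enum [pred z | c z == c x]) :> nat}.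
  have lt : index x (enum [pred z | c z == c x]) < #|[pred y | d y == c x]|.
    by rewrite -eq_fib cardE index_mem mem_enum inE.
  by exists (Ordinal lt).
pose f x := enum_val (sval (fibP x)).
have df x : d (f x) = c x.
  by have := enum_valP (sval (fibP x)); rewrite inE => /eqP.
exists f => //; apply: inj_card_bij => [x y fxy|].
  have cxy : c x = c y by rewrite -!df fxy.
  move: fxy; rewrite /f; case: (fibP x) (fibP y) => i Ei [j Ej] /=.
  (* Both positions must lie in the same ordinal type before [enum_val_inj] applies. *)
  move: i j Ei Ej; rewrite cxy => i j Ei Ej /enum_val_inj eij.
  have xin : x \in enum [pred z | c z == c y] by rewrite mem_enum inE cxy.
  have yin : y \in enum [pred z | c z == c y] by rewrite mem_enum inE.
  pose s := enum [pred z | c z == c y].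
  have: nth x s (index x s) = nth x s (index y s).
    by rewrite -Ei -Ej eij.
  by rewrite !nth_index.
rewrite -[leqRHS]sum1_card -[leqLHS]sum1_card.
rewrite (partition_big c predT) // [leqLHS](partition_big d predT) //=.
by apply: leq_sum => i _; rewrite !sum1_card eq_fib.
Qed.

(** The label [None] stands for the cut, so that labellings of [G] can be built from the partial map
    [insub]. *)
Definition part (a b k : nat) (x : two_cliques_join a b k) : option bool :=
  match x with
  | inl (inl _) => Some true
  | inl (inr _) => Some false
  | inr _ => None
  end.

Lemma edge_two_cliques_join (a b k : nat) (x y : two_cliques_join a b k) :
  edge x y = (x != y) && [|| part x == part y, part x == None | part y == None].
Proof. by case: x y => [[i|i]|i] [[j|j]|j]; rewrite /= ?andbT. Qed.

Lemma card_part (a b k : nat) (i : option bool) :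
  #|[pred x : two_cliques_join a b k | part x == i]| =
  if i is Some i then if i then a else b else k.
Proof.
rewrite -sum1_card big_sumType /= big_sumType /=.
by case: i => [[]|]; rewrite /= !sum1_card ?card0 ?card_ord ?addn0 ?add0n.
Qed.

(** The target has every edge that the labels permit, so any bijection preserving labels is a
    homomorphism. *)
Lemma hom_to_two_cliques_join (G : sgraph) (c : G -> option bool) :
  (forall x y, edge x y -> [|| c x == c y, c x == None | c y == None]) ->
  exists2 f : G -> two_cliques_join #|[pred x | c x == Some true]|
      #|[pred x | c x == Some false]| #|[pred x | c x == None]|,
    bijective f & forall x y, edge x y -> edge (f x) (f y).
Proof.
move=> edge_c.
have [|f bf partf] := @bij_of_card_fibers G (two_cliques_join
  #|[pred x | c x == Some true]| #|[pred x | c x == Some false]|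
  #|[pred x | c x == None]|) _ c (@part _ _ _).
  by move=> i; rewrite card_part; case: i => [[]|].
exists f => // x y exy; rewrite edge_two_cliques_join !partf edge_c // andbT.
by rewrite (inj_eq (bij_inj bf)); apply: contraTneq exy => ->; rewrite edge_irr.
Qed.

Lemma card_option_bool_fibers (T : finType) (c : T -> option bool) :
  #|[pred x | c x == Some true]| + #|[pred x | c x == Some false]|
  + #|[pred x | c x == None]| = #|T|.
Proof.
rewrite -[RHS](cardC [pred x | c x == None]) addnC; congr (_ + _).
rewrite -(cardID [pred x | c x == Some true] (predC _)); congr (_ + _);
  by apply: eq_card => x; rewrite !inE; case: (c x) => [[]|].
Qed.

Lemma minimum_cut (G : sgraph) :
  ~~ complete G -> vertex_connectivity G < #|G| ->
  exists2 S : {set G}, disconnecting S & #|S| = vertex_connectivity G.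
Proof.
rewrite /vertex_connectivity => /negbTE->.
(* The bound on [m] is kept in the invariant to exclude the default value [#|G|], which no cut need
   attain. *)
apply: (big_ind (fun m => m < #|G| ->
  exists2 S : {set G}, disconnecting S & #|S| = m)).
- by rewrite ltnn.
- by move=> m1 m2 IH1 IH2; rewrite /minn; case: ifP.
- by move=> S discS _; exists S.
Qed.

Lemma vertex_connectivity_hom (G : sgraph) :
  0 < vertex_connectivity G < #|G| ->
  exists a b, [/\ a + b + vertex_connectivity G = #|G|, 0 < b,
    a = 0 -> b = 1 &
    exists2 f : G -> two_cliques_join a b (vertex_connectivity G),
      bijective f & forall x y, edge x y -> edge (f x) (f y)].
Proof.
move=> /andP[k0 kn].
case: (boolP (complete G)) => [Gc | nGc].
  (* In a complete graph a single vertex [z] forms the second clique and all others play the cut,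
     whence [a = 0] and [b = 1]. *)
  have [z _] : exists z : G, true.
    by case/card_gt0P: (leq_ltn_trans (leq0n _) kn) => z; exists z.
  pose c x := if x == z then Some false else None : option bool.
  have [|f bf homf] := @hom_to_two_cliques_join G c.
    by move=> x y; rewrite /c; do 2?case: ifP.
  have c1 : #|[pred x | c x == Some true]| = 0.
    by apply: eq_card0 => x; rewrite !inE /c; case: ifP.
  have c2 : #|[pred x | c x == Some false]| = 1.
    by rewrite -(card1 z); apply: eq_card => x; rewrite !inE /c; case: ifP.
  have c3 : #|[pred x | c x == None]| = vertex_connectivity G.
    have := card_option_bool_fibers c.
    by rewrite /vertex_connectivity Gc c1 c2 => <-.
  exists 0, 1; split=> //.
    by rewrite -[RHS](card_option_bool_fibers c) c1 c2 c3.
  by move: f bf homf; rewrite c1 c2 c3 => f; exists f.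
have [S + cardS] := minimum_cut nGc kn.
rewrite /disconnecting negb_forall => /existsP[x].
rewrite negb_forall => /existsP[y nxy].
(* A surviving vertex is labelled by whether it lies in the component of [x]. Then [x] and [y] show
   that both classes are nonempty. *)
pose c z := omap (connect (@edge (induced (~: S))) x) (insub z).
have [|f bf homf] := @hom_to_two_cliques_join G c.
  move=> u v euv; rewrite /c.
  case: insubP => [u' _ Eu|]; case: insubP => [v' _ Ev|] //=;
    rewrite ?eqxx ?orbT //.
  rewrite !orbF; apply/eqP; congr Some.
  apply: same_connect_r; first exact/sym_connect_sym/induced_edge_sym.
  by apply: connect1; rewrite /= /induced_edge Eu Ev.
have cN : #|[pred x | c x == None]| = vertex_connectivity G.
  rewrite -cardS; apply: eq_card => z; rewrite !inE /c.
  by case: insubP => [z' |]; rewrite inE ?negbK // => /negbTE->.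
have cx : 0 < #|[pred x | c x == Some true]|.
  by apply/card_gt0P; exists (val x); rewrite inE /c valK /= connect0.
have cy : 0 < #|[pred x | c x == Some false]|.
  by apply/card_gt0P; exists (val y); rewrite inE /c valK /= (negbTE nxy).
exists #|[pred x | c x == Some true]|, #|[pred x | c x == Some false]|.
rewrite -cN card_option_bool_fibers; split=> //; last by exists f.
by move=> E; rewrite E in cx.
Qed.

(** * The bound and its equality case *)

Theorem theorem5p2 (R : realType) (n k : nat) (G : sgraph) :
  2 <= n -> 1 <= k <= n - 1 ->
  #|G| = n -> connected G -> vertex_connectivity G = k ->
  (sombor R G <= sombor_bound R n k)%R
  /\ (sombor R G = sombor_bound R n k
      <-> giso G (gjoin (gunion (K (n - k - 1)) (K 1)) (K k))).
Proof.
move=> n2 /andP[k0 kn] cardG _ kG.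
have boundE : sombor_bound R n k = sombor R (two_cliques_join (n - k - 1) 1 k).
  rewrite sombor_two_cliques_join // (_ : n - k - 1 + 1 + k = n); last by lia.
  rewrite /sombor_bound /clique_weight (_ : 'C(1, 2) = 0) // [1 + k]addnC addnK.
  have -> : n - k - 1 + k - 1 = n - 2 by lia.
  by ring.
have [|a [b [abk b0 a0 [f bf homf]]]] := @vertex_connectivity_hom G.
  by rewrite kG cardG; lia.
rewrite kG cardG in abk f bf homf.
have leG := sombor_hom R bf homf.
have leT : (sombor R (two_cliques_join a b k) <= sombor_bound R n k
    ?= iff ((a <= 1) || (b == 1))%N)%R.
  have [a_eq0|] := posnP a.
    have b1 := a0 a_eq0; have E : n - k - 1 = a by lia.
    by rewrite boundE E b1 eqxx orbT; apply/leif_refl.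
  (* Both parts are now nonempty, and passing to predecessors fits the shifted arguments of
     [strictly_convex_spread]. *)
  case: a b b0 abk {a0 f bf homf leG} => // a [//|b] _ abk _.
  have := strictly_convex_spread a b (fun x => clique_weight_convex R n x k0).
  rewrite boundE !sombor_two_cliques_join // abk.
  have -> : n - k - 1 = (a + b).+1 by lia.
  have -> : (a + b).+1 + 1 + k = n by lia.
  rewrite /Order.leif !lerD2r !eqSS ltnS leqn0 => -[-> <-]; split=> //.
  by rewrite (inj_eq (addIr _)).
split; first exact: le_trans leG leT.
split=> [/eqP eqG | [g bg edgeg]].
  have := leif_trans leG leT; rewrite /Order.leif eqG.
  (* Equality throughout the chain makes [f] an isomorphism and forces a part of size at most
     one. *)
  move=> [_ /esym/andP[/forallP iso ab]].
  have edgef x y : edge (f x) (f y) = edge x y.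
    by apply/eqP; exact: (iso (x, y)).
  case/orP: ab => [a1|/eqP b1].
    have [a_eq0|a_gt0] := posnP a.
      have E : n - k - 1 = a by have := a0 a_eq0; lia.
      by rewrite E -(a0 a_eq0); exists f.
    (* Here [a = 1], so the single vertex is the first clique and the two cliques must be
       swapped. *)
    have E : n - k - 1 = b by lia.
    have E1 : K 1 = K a by congr K; lia.
    have [h bh edgeh] := giso_two_cliques_joinC a b k.
    rewrite E E1; exists (h \o f) => [|x y]; first exact: bij_comp.
    exact: etrans (edgeh _ _) (edgef _ _).
  have E : n - k - 1 = a by lia.
  by rewrite E -b1; exists f.
apply/eqP; rewrite boundE (sombor_hom R bg) => [|x y]; last by rewrite edgeg.
by apply/forallP => p; rewrite edgeg.
Qed.
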